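(* In the language of Peano Arithmetic extended by a unary predicate symbol $K$, the following system is consistent ($\phi,\psi$ range over all formulas of the extended language): (1) (Global) the axioms of Peano Arithmetic; (2) (Global) $K(\ulcorner\phi\rightarrow\psi\urcorner)\rightarrow (K(\ulcorner\phi\urcorner)\rightarrow K(\ulcorner\psi\urcorner))$; (3) (Global) $K(\ulcorner\phi\urcorner)\rightarrow K(\ulcorner K(\ulcorner\phi\urcorner)\urcorner)$; (4) (Local) $K(\ulcorner\phi\urcorner)\rightarrow\phi$; (5) the rule of global necessitation for $K$.
   Context: $\ulcorner\phi\urcorner$ is the numeral of the Gödel number of $\phi$. The logic is classical first-order logic. The axioms of Peano Arithmetic are those in the language of PA (induction for formulas of the language of PA). Systems and derivability: for a system $S$ consisting of a set of global axioms, a set of local axioms, and the rule of global necessitation for $K$ (with modus ponens implicitly included), $S\models\phi$ means that there is a finite sequence $\phi_1,\ldots,\phi_m$ with $\phi_m=\phi$ such that for each $i$ one of the following holds: (i) $\phi_i$ is a local axiom; (ii) $\phi_i$ is a global axiom; (iii) $\phi_i$ is logically valid; (iv) $\phi_i$ follows from two earlier members of the sequence by modus ponens; (v) $\phi_i$ is $K(\ulcorner\phi_j\urcorner)$ for some $j<i$ such that for every $1\le k\le j$, $\phi_k$ is an instance of one of items (ii)-(v) of this list (so local axioms are not used up to step $j$). The system is consistent if it does not derive a contradiction $\chi\wedge\neg\chi$. *)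

(* Defs.v *)
From Stdlib Require Import Arith Cantor List Classical.
Import ListNotations.

(** Variables are de Bruijn indices: [Var 0] is bound by the nearest quantifier. *)

Inductive term : Type :=
| Var (n : nat)
| Zero
| Succ (t : term)
| Add (t u : term)
| Mul (t u : term).

Inductive form : Type :=
| Eq (t u : term)
| K (t : term)
| Not (p : form)
| And (p q : form)
| Or (p q : form)
| Imp (p q : form)
| All (p : form)
| Ex (p : form).

Fixpoint arithmetical (p : form) : Prop :=
  match p with
  | Eq _ _ => True
  | K _ => False
  | Not p | All p | Ex p => arithmetical p
  | And p q | Or p q | Imp p q => arithmetical p /\ arithmetical q
  end.

Fixpoint tsubst (s : nat -> term) (t : term) : term :=
  match t with
  | Var n => s n
  | Zero => Zero
  | Succ t => Succ (tsubst s t)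
  | Add t u => Add (tsubst s t) (tsubst s u)
  | Mul t u => Mul (tsubst s t) (tsubst s u)
  end.

Definition up (s : nat -> term) (n : nat) : term :=
  match n with
  | 0 => Var 0
  | S m => tsubst (fun k => Var (S k)) (s m)
  end.

Fixpoint fsubst (s : nat -> term) (p : form) : form :=
  match p with
  | Eq t u => Eq (tsubst s t) (tsubst s u)
  | K t => K (tsubst s t)
  | Not p => Not (fsubst s p)
  | And p q => And (fsubst s p) (fsubst s q)
  | Or p q => Or (fsubst s p) (fsubst s q)
  | Imp p q => Imp (fsubst s p) (fsubst s q)
  | All p => All (fsubst (up s) p)
  | Ex p => Ex (fsubst (up s) p)
  end.

(** [tbound t] and [fbound p] are the least [n] such that all free variables
    have index less than [n]. *)

Fixpoint tbound (t : term) : nat :=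
  match t with
  | Var n => S n
  | Zero => 0
  | Succ t => tbound t
  | Add t u | Mul t u => Nat.max (tbound t) (tbound u)
  end.

Fixpoint fbound (p : form) : nat :=
  match p with
  | Eq t u => Nat.max (tbound t) (tbound u)
  | K t => tbound t
  | Not p => fbound p
  | And p q | Or p q | Imp p q => Nat.max (fbound p) (fbound q)
  | All p | Ex p => Nat.pred (fbound p)
  end.

Definition closure (p : form) : form := Nat.iter (fbound p) All p.

Fixpoint tcode (t : term) : nat :=
  match t with
  | Var n => to_nat (0, n)
  | Zero => to_nat (1, 0)
  | Succ t => to_nat (2, tcode t)
  | Add t u => to_nat (3, to_nat (tcode t, tcode u))
  | Mul t u => to_nat (4, to_nat (tcode t, tcode u))
  end.

Fixpoint fcode (p : form) : nat :=
  match p with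
  | Eq t u => to_nat (0, to_nat (tcode t, tcode u))
  | K t => to_nat (1, tcode t)
  | Not p => to_nat (2, fcode p)
  | And p q => to_nat (3, to_nat (fcode p, fcode q))
  | Or p q => to_nat (4, to_nat (fcode p, fcode q))
  | Imp p q => to_nat (5, to_nat (fcode p, fcode q))
  | All p => to_nat (6, fcode p)
  | Ex p => to_nat (7, fcode p)
  end.

Lemma to_nat_inj (a b c d : nat) :
  to_nat (a, b) = to_nat (c, d) -> a = c /\ b = d.
Proof.
  intros H. apply (f_equal of_nat) in H. rewrite !cancel_of_to in H.
  injection H; auto.
Qed.

Lemma tcode_inj (t u : term) : tcode t = tcode u -> t = u.
Proof.
  revert u; induction t; intros [] H; cbn -[to_nat] in H;
    apply to_nat_inj in H; destruct H as [H1 H2]; try discriminate H1;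
    try (apply to_nat_inj in H2; destruct H2); f_equal; auto.
Qed.

Lemma fcode_inj (p q : form) : fcode p = fcode q -> p = q.
Proof.
  revert q; induction p; intros [] H; cbn -[to_nat] in H;
    apply to_nat_inj in H; destruct H as [H1 H2]; try discriminate H1;
    try (apply to_nat_inj in H2; destruct H2); f_equal; auto using tcode_inj.
Qed.

Definition numeral (n : nat) : term := Nat.iter n Succ Zero.

Definition quote (p : form) : term := numeral (fcode p).

Record structure : Type := {
  carrier : Type;
  zeroI : carrier;
  succI : carrier -> carrier;
  addI : carrier -> carrier -> carrier;
  mulI : carrier -> carrier -> carrier;
  KI : carrier -> Prop
}.

Fixpoint eval (M : structure) (v : nat -> carrier M) (t : term) : carrier M :=
  match t with
  | Var n => v n
  | Zero => zeroI M
  | Succ t => succI M (eval M v t)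
  | Add t u => addI M (eval M v t) (eval M v u)
  | Mul t u => mulI M (eval M v t) (eval M v u)
  end.

Definition scons {A : Type} (x : A) (v : nat -> A) (n : nat) : A :=
  match n with
  | 0 => x
  | S m => v m
  end.

Fixpoint sat (M : structure) (v : nat -> carrier M) (p : form) : Prop :=
  match p with
  | Eq t u => eval M v t = eval M v u
  | K t => KI M (eval M v t)
  | Not p => ~ sat M v p
  | And p q => sat M v p /\ sat M v q
  | Or p q => sat M v p \/ sat M v q
  | Imp p q => sat M v p -> sat M v q
  | All p => forall x, sat M (scons x v) p
  | Ex p => exists x, sat M (scons x v) p
  end.

(** The metatheory is classical, so this is validity for classical first-order
    logic with equality: see [valid_excluded_middle]. *)
Definition valid (p : form) : Prop :=
  forall (M : structure) (v : nat -> carrier M), sat M v p.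

Lemma valid_excluded_middle (p : form) : valid (Or p (Not p)).
Proof. intros M v; apply classic. Qed.

Definition subst_zero (p : form) : form := fsubst (scons Zero Var) p.

(** Replaces [Var 0] by its successor without lowering the other indices, so
    that the result can again be put under the quantifier binding [Var 0]. *)
Definition subst_succ (p : form) : form :=
  fsubst (scons (Succ (Var 0)) (fun n => Var (S n))) p.

Definition induction_formula (p : form) : form :=
  Imp (And (subst_zero p) (All (Imp p (subst_succ p)))) (All p).

Inductive PA : form -> Prop :=
| PA_succ_neq_zero : PA (All (Not (Eq (Succ (Var 0)) Zero)))
| PA_succ_inj :
    PA (All (All (Imp (Eq (Succ (Var 1)) (Succ (Var 0))) (Eq (Var 1) (Var 0)))))
| PA_add_zero : PA (All (Eq (Add (Var 0) Zero) (Var 0)))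
| PA_add_succ :
    PA (All (All (Eq (Add (Var 1) (Succ (Var 0))) (Succ (Add (Var 1) (Var 0))))))
| PA_mul_zero : PA (All (Eq (Mul (Var 0) Zero) Zero))
| PA_mul_succ :
    PA (All (All (Eq (Mul (Var 1) (Succ (Var 0)))
                     (Add (Mul (Var 1) (Var 0)) (Var 1)))))
| PA_induction (p : form) : arithmetical p -> PA (closure (induction_formula p)).

Record system : Type := {
  global_axiom : form -> Prop;
  local_axiom : form -> Prop
}.

(** [global_step T s i]: the entry of [s] at position [i] (counted from 0) is
    justified without being taken as a local axiom. *)
Inductive global_step (T : system) (s : list form) (i : nat) : Prop :=
| step_axiom (p : form) :
    nth_error s i = Some p -> global_axiom T p -> global_step T s i
| step_valid (p : form) :
    nth_error s i = Some p -> valid p -> global_step T s i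
| step_modus_ponens (j k : nat) (p q : form) :
    j < i -> k < i ->
    nth_error s j = Some (Imp p q) -> nth_error s k = Some p ->
    nth_error s i = Some q -> global_step T s i
| step_necessitation (j : nat) (p : form) :
    j < i ->
    nth_error s j = Some p -> nth_error s i = Some (K (quote p)) ->
    (forall k, k <= j -> global_step T s k) -> global_step T s i.

Definition local_step (T : system) (s : list form) (i : nat) : Prop :=
  exists p, nth_error s i = Some p /\ local_axiom T p.

Definition derivation (T : system) (s : list form) : Prop :=
  forall i, i < length s -> local_step T s i \/ global_step T s i.

Definition derives (T : system) (p : form) : Prop :=
  exists s, derivation T (s ++ [p]).

Definition consistent (T : system) : Prop :=
  ~ exists p, derives T (And p (Not p)).

Inductive knowledge_global : form -> Prop :=
| global_PA (p : form) : PA p -> knowledge_global p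
| global_K_imp (p q : form) :
    knowledge_global
      (Imp (K (quote (Imp p q))) (Imp (K (quote p)) (K (quote q))))
| global_K_K (p : form) :
    knowledge_global (Imp (K (quote p)) (K (quote (K (quote p))))).

Inductive knowledge_local : form -> Prop :=
| local_K_true (p : form) : knowledge_local (Imp (K (quote p)) p).

Definition knowledge_system : system :=
  {| global_axiom := knowledge_global; local_axiom := knowledge_local |}.

(* Main.v *)
From Stdlib Require Import Arith List Lia.
Require Import Defs.

(** The system has a model. Take the natural numbers with their usual
    arithmetic, and let [K] hold of exactly the codes of the global theorems:
    the formulas obtained without local axioms. Three things have to be seen.

    The global axioms hold in this structure. The axioms of Peano Arithmetic
    do, because its arithmetical part is standard. The axioms on [K] say that
    the global theorems are closed under modus ponens and under necessitation,
    and they are so by definition.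

    Hence every global theorem holds in the structure
    ([global_theorem_true]): the rules preserve truth, and [K] of a global
    theorem is true by the choice of [K].

    This soundness is just what the local axioms say: if [K] holds of the code
    of [p], then [p] is a global theorem, so [p] is true. There is no circle,
    since [K] refers only to proofs in which the local axioms do not occur.
    So every line of every derivation is true in the structure
    ([derivation_true]), and a contradiction is not. *)

(** * Substitution and satisfaction *)

Lemma eval_ext (M : structure) (t : term) (v w : nat -> carrier M) :
  (forall n, v n = w n) -> eval M v t = eval M w t.
Proof. intros E; induction t; cbn; congruence. Qed.

Lemma scons_ext {A : Type} (x : A) (v w : nat -> A) :
  (forall n, v n = w n) -> forall n, scons x v n = scons x w n.
Proof. intros E [|n]; cbn; auto. Qed.

(** Pointwise equality of assignments stands in for equality, so that no
    extensionality axiom enters the treatment of quantifiers. *)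
Lemma sat_ext (M : structure) (p : form) (v w : nat -> carrier M) :
  (forall n, v n = w n) -> sat M v p <-> sat M w p.
Proof.
  revert v w; induction p; intros v w E; cbn.
  - rewrite !(eval_ext M _ v w E); tauto.
  - rewrite (eval_ext M _ v w E); tauto.
  - specialize (IHp v w E); tauto.
  - specialize (IHp1 v w E); specialize (IHp2 v w E); tauto.
  - specialize (IHp1 v w E); specialize (IHp2 v w E); tauto.
  - specialize (IHp1 v w E); specialize (IHp2 v w E); tauto.
  - split; intros H x; apply (IHp _ _ (scons_ext x v w E)), H.
  - split; intros [x H]; exists x; apply (IHp _ _ (scons_ext x v w E)), H.
Qed.

Lemma eval_tsubst (M : structure) (s : nat -> term) (t : term)
    (v : nat -> carrier M) :
  eval M v (tsubst s t) = eval M (fun n => eval M v (s n)) t.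
Proof. induction t; cbn; congruence. Qed.

Lemma eval_up (M : structure) (s : nat -> term) (x : carrier M)
    (v : nat -> carrier M) (n : nat) :
  eval M (scons x v) (up s n) = scons x (fun k => eval M v (s k)) n.
Proof. destruct n; cbn; [reflexivity | apply eval_tsubst]. Qed.

Lemma sat_fsubst (M : structure) (p : form) (s : nat -> term)
    (v : nat -> carrier M) :
  sat M v (fsubst s p) <-> sat M (fun n => eval M v (s n)) p.
Proof.
  revert s v; induction p; intros s v; cbn.
  - rewrite !eval_tsubst; tauto.
  - rewrite eval_tsubst; tauto.
  - specialize (IHp s v); tauto.
  - specialize (IHp1 s v); specialize (IHp2 s v); tauto.
  - specialize (IHp1 s v); specialize (IHp2 s v); tauto.
  - specialize (IHp1 s v); specialize (IHp2 s v); tauto.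
  - split; intros H x; specialize (H x).
    + now apply IHp, (sat_ext _ _ _ _ (eval_up M s x v)) in H.
    + now apply IHp, (sat_ext _ _ _ _ (eval_up M s x v)).
  - split; intros [x H]; exists x.
    + now apply IHp, (sat_ext _ _ _ _ (eval_up M s x v)) in H.
    + now apply IHp, (sat_ext _ _ _ _ (eval_up M s x v)).
Qed.

Lemma sat_closure (M : structure) (p : form) :
  (forall v, sat M v p) -> forall v, sat M v (closure p).
Proof.
  intros H; unfold closure; induction (fbound p) as [|n IHn]; cbn; auto.
Qed.

(** * Standard structures *)

Definition standard (A : form -> Prop) : structure :=
  {| carrier := nat; zeroI := 0; succI := S; addI := Nat.add; mulI := Nat.mul;
     KI := fun n => exists p, fcode p = n /\ A p |}.

Lemma eval_numeral (A : form -> Prop) (v : nat -> nat) (n : nat) :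
  eval (standard A) v (numeral n) = n.
Proof. induction n as [|n IHn]; [reflexivity | exact (f_equal S IHn)]. Qed.

(** This is where the injectivity of the coding is used: a number can be the
    code of a formula in [A] only by being the code of that same formula. *)
Lemma sat_K_quote (A : form -> Prop) (v : nat -> nat) (p : form) :
  sat (standard A) v (K (quote p)) <-> A p.
Proof.
  cbn [sat]; unfold quote; rewrite eval_numeral; cbn; split.
  - intros [q [E H]]; now rewrite <- (fcode_inj _ _ E).
  - intros H; now exists p.
Qed.

(** The carrier is the actual set of natural numbers, so induction in the
    metatheory applies to the property that [p] defines under [v]. *)
Lemma sat_induction_formula (A : form -> Prop) (p : form) (v : nat -> nat) :
  sat (standard A) v (induction_formula p).
Proof.
  cbn; intros [H0 HS] x; induction x as [|x IHx].
  - apply sat_fsubst in H0; revert H0; apply sat_ext; intros [|n]; reflexivity.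
  - generalize (HS x IHx); intros H; apply sat_fsubst in H.
    revert H; apply sat_ext; intros [|n]; reflexivity.
Qed.

Lemma PA_true (A : form -> Prop) (p : form) :
  PA p -> forall v, sat (standard A) v p.
Proof.
  intros H; destruct H; try (intros v; cbn; intros; lia).
  apply sat_closure, sat_induction_formula.
Qed.

(** * Global theorems *)

(** Proofs as trees rather than sequences: the side condition of necessitation
    on all earlier lines disappears, and closure under the rules is immediate. *)
Inductive global_theorem (T : system) : form -> Prop :=
| theorem_axiom (p : form) : global_axiom T p -> global_theorem T p
| theorem_valid (p : form) : valid p -> global_theorem T p
| theorem_modus_ponens (p q : form) :
    global_theorem T (Imp p q) -> global_theorem T p -> global_theorem T q
| theorem_necessitation (p : form) :
    global_theorem T p -> global_theorem T (K (quote p)).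

(** A single global step may apply modus ponens to local axioms; it is the
    absence of local axioms in the whole initial segment, as necessitation
    demands it, that makes its lines global theorems. *)
Lemma global_steps_theorem (T : system) (s : list form) (j : nat) :
  (forall k, k <= j -> global_step T s k) ->
  forall k p, k <= j -> nth_error s k = Some p -> global_theorem T p.
Proof.
  intros G k; induction k as [k IH] using lt_wf_ind; intros p Hk Hp.
  destruct (G k Hk) as [q Hq H | q Hq H | i l q r Hi Hl Hi' Hl' Hr
                       | i q Hi Hi' Hq _].
  - rewrite Hp in Hq; injection Hq as <-; now apply theorem_axiom.
  - rewrite Hp in Hq; injection Hq as <-; now apply theorem_valid.
  - rewrite Hp in Hr; injection Hr as <-.
    apply (theorem_modus_ponens T q p);
      [apply (IH i) | apply (IH l)]; auto; lia.
  - rewrite Hp in Hq; injection Hq as ->.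
    apply theorem_necessitation, (IH i); auto; lia.
Qed.

(** * Truth of the knowledge system *)

Definition knowledge_model : structure :=
  standard (global_theorem knowledge_system).

Lemma knowledge_global_true (p : form) :
  knowledge_global p -> forall v, sat knowledge_model v p.
Proof.
  intros [q H | q r | q] v.
  - now apply PA_true.
  - change (sat knowledge_model v (K (quote (Imp q r))) ->
            sat knowledge_model v (K (quote q)) ->
            sat knowledge_model v (K (quote r))).
    unfold knowledge_model; rewrite !sat_K_quote.
    apply theorem_modus_ponens.
  - change (sat knowledge_model v (K (quote q)) ->
            sat knowledge_model v (K (quote (K (quote q))))).
    unfold knowledge_model; rewrite !sat_K_quote.
    apply theorem_necessitation.
Qed.

Lemma global_theorem_true (p : form) :
  global_theorem knowledge_system p -> forall v, sat knowledge_model v p.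
Proof.
  intros H; induction H as [p H | p H | p q _ IHpq _ IHp | p H _]; intros v.
  - now apply knowledge_global_true.
  - apply H.
  - exact (IHpq v (IHp v)).
  - now apply sat_K_quote.
Qed.

Lemma knowledge_local_true (p : form) :
  knowledge_local p -> forall v, sat knowledge_model v p.
Proof.
  intros [q] v H; apply global_theorem_true.
  exact (proj1 (sat_K_quote _ v q) H).
Qed.

(** Truth alone would not carry an induction through necessitation, since a
    true formula need not be a global theorem; [global_steps_theorem] supplies
    that case. *)
Lemma derivation_true (s : list form) :
  derivation knowledge_system s ->
  forall i p, nth_error s i = Some p -> forall v, sat knowledge_model v p.
Proof.
  intros D i; induction i as [i IH] using lt_wf_ind; intros p Hp v.
  assert (Hi : i < length s) by (apply nth_error_Some; congruence).
  destruct (D i Hi) as [[q [Hq H]] | [q Hq H | q Hq H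
                       | j k q r Hj Hk Hj' Hk' Hr | j q Hj Hj' Hq G]].
  - rewrite Hp in Hq; injection Hq as <-; now apply knowledge_local_true.
  - rewrite Hp in Hq; injection Hq as <-; now apply knowledge_global_true.
  - rewrite Hp in Hq; injection Hq as <-; apply H.
  - rewrite Hp in Hr; injection Hr as <-.
    exact (IH j Hj _ Hj' v (IH k Hk _ Hk' v)).
  - rewrite Hp in Hq; injection Hq as ->.
    apply sat_K_quote, (global_steps_theorem _ s j G j); auto.
Qed.

Theorem theorem1p2 : consistent knowledge_system.
Proof.
  intros [p [s D]].
  assert (E : nth_error (s ++ And p (Not p) :: nil) (length s)
              = Some (And p (Not p)))
    by (rewrite nth_error_app2, Nat.sub_diag; auto).
  destruct (derivation_true _ D _ _ E (fun _ => 0)) as [H N].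
  exact (N H).
Qed.
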